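(* Let $E=E(\mathcal L,D,\kappa)$, where $\mathcal L$ is a centerless Lie $\Lambda$-torus, $D$ is a permissible subalgebra of $\mathrm{SCDer}(\mathcal L)$ with $D=D^0$ or $D=\mathrm{SCDer}(\mathcal L)$, and $\kappa$ is an affine cocycle on $D$. Then any Chevalley involution of $\mathcal L$ extends to a Chevalley involution of the core $E_c=\mathcal L\oplus D^{gr\star}$.
   Context: Everything is over the field $\mathbb K=\mathbb C$. **Lie tori.** $\Lambda$ is a free abelian group of finite rank; $\Delta$ is a finite irreducible root system (containing $0$), $\Delta^\times=\Delta\setminus\{0\}$, $Q=\mathrm{span}_{\mathbb Z}\Delta$, $\Delta_{\mathrm{ind}}=\{0\}\cup\{\alpha\in\Delta^\times:\alpha/2\notin\Delta\}$, and $\langle\beta,\alpha^\vee\rangle$ are the Cartan integers. A Lie $\Lambda$-torus of type $\Delta$ is a Lie algebra $\mathcal L=\bigoplus_{(\alpha,\lambda)\in Q\times\Lambda}\mathcal L_\alpha^\lambda$, graded by $Q\times\Lambda$, such that: (LT1) $\mathcal L_\alpha^\lambda=0$ if $\alpha\notin\Delta$; (LT2) for $\alpha\in\Delta^\times$, $\lambda\in\Lambda$: $\dim\mathcal L_\alpha^\lambda\le1$, with $\dim\mathcal L_\alpha^0=1$ if $\alpha\in\Delta_{\mathrm{ind}}$; and if $\dim\mathcal L_\alpha^\lambda=1$ there are $e_\alpha^\lambda,f_\alpha^\lambda$ with $\mathcal L_\alpha^\lambda=\mathbb K e_\alpha^\lambda$, $\mathcal L_{-\alpha}^{-\lambda}=\mathbb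 K f_\alpha^\lambda$ and $[[e_\alpha^\lambda,f_\alpha^\lambda],x]=\langle\beta,\alpha^\vee\rangle x$ for all $x\in\mathcal L_\beta^\mu$, $\beta\in\Delta$, $\mu\in\Lambda$; (LT3) $\mathcal L_0^\lambda=\sum_{\alpha\in\Delta^\times,\mu\in\Lambda}[\mathcal L_\alpha^\mu,\mathcal L_{-\alpha}^{\lambda-\mu}]$; (LT4) $\Lambda$ is generated by $\{\lambda:\mathcal L_\alpha^\lambda\ne0\text{ for some }\alpha\in\Delta\}$. Put $\mathcal L^\lambda=\bigoplus_\alpha\mathcal L_\alpha^\lambda$. $\mathcal L$ is centerless if its center is $0$. A Chevalley involution of a Lie torus $\mathcal L$ is a Lie algebra automorphism $\tau$ of order $2$ with $\tau(\mathcal L^\lambda)=\mathcal L^{-\lambda}$ for all $\lambda\in\Lambda$ and $\tau(h)=-h$ for all $h\in\mathcal L_0^0$. **Skew centroidal derivations.** Let $\mathcal L$ be centerless. Its centroid is $\mathrm{Cent}(\mathcal L)=\bigoplus_{\mu\in\Gamma}\mathbb K\chi^\mu$, where $\Gamma\le\Lambda$ is a subgroup, $\chi^\mu$ has degree $\mu$ and $\chi^\mu\chi^\nu=\chi^{\mu+\nu}$. For $\theta\in\mathrm{Hom}_{\mathbb Z}(\Lambda,\mathbb K)$ let $\partial_\theta$ be the derivation $\partial_\theta(x)=\theta(\lambda)x$, $x\in\mathcal L^\lambda$. Fix a non-degenerate invariant symmetric $\Lambda$-graded bilinear form $(\cdot,\cdot)_{\mathcal L}$ on $\mathcal L$. Put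 $\mathrm{SCDer}(\mathcal L)=\bigoplus_{\mu\in\Gamma}\mathrm{SCDer}(\mathcal L)^\mu$, $\mathrm{SCDer}(\mathcal L)^\mu=\{\chi^\mu\partial_\theta:\theta\in\mathrm{Hom}_{\mathbb Z}(\Lambda,\mathbb K),\ \theta(\mu)=0\}$, a $\Gamma$-graded Lie algebra under the commutator. A subalgebra $D$ of $\mathrm{SCDer}(\mathcal L)$ is permissible if it is $\Gamma$-graded, $D=\bigoplus_{\mu\in\Gamma}D^\mu$ with $D^\mu=D\cap\mathrm{SCDer}(\mathcal L)^\mu$, and the evaluation map $\mathrm{ev}:\Lambda\to(D^0)^\star$, $\mathrm{ev}(\lambda)(\partial_\theta)=\theta(\lambda)$, is injective with discrete image. The graded dual $D^{gr\star}=\bigoplus_\mu(D^\mu)^\star$ (elements of $(D^\mu)^\star$ extended by $0$ to the other $D^\nu$), graded by $(D^{gr\star})^\mu=(D^{-\mu})^\star$, is a $D$-module via $(d\cdot\varphi)(d')=\varphi([d',d])$. An affine cocycle on $D$ is a bilinear map $\kappa:D\times D\to D^{gr\star}$ such that, for all $d,d_1,d_2,d_3\in D$ and $\mu_1,\mu_2\in\Gamma$: $\kappa(d,d)=0$; $\sum\kappa([d_i,d_j],d_k)=\sum d_i\cdot\kappa(d_j,d_k)$ (sums over cyclic permutations $(i,j,k)$ of $(1,2,3)$); $\kappa(D^{\mu_1},D^{\mu_2})\subseteq(D^{-\mu_1-\mu_2})^\star$; $\kappa(d_1,d_2)(d_3)=\kappa(d_2,d_3)(d_1)$; $\kappa(D^0,D)=0$.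 **The algebra $E(\mathcal L,D,\kappa)$.** $E=\mathcal L\oplus D^{gr\star}\oplus D$ with bracket $$[x_1+c_1+d_1,x_2+c_2+d_2]=\big([x_1,x_2]_{\mathcal L}+d_1(x_2)-d_2(x_1)\big)+\big(\sigma_D(x_1,x_2)+d_1\cdot c_2-d_2\cdot c_1+\kappa(d_1,d_2)\big)+[d_1,d_2],$$ where $\sigma_D(x,y)(d)=(d(x),y)_{\mathcal L}$. It is an extended affine Lie algebra with Cartan subalgebra $\mathcal L_0^0\oplus(D^0)^\star\oplus D^0$; its core (the subalgebra generated by the non-isotropic root spaces) is $E_c=\mathcal L\oplus D^{gr\star}$, which is a Lie $\Lambda$-torus with $(E_c)^\lambda=\mathcal L^\lambda\oplus(D^{-\lambda})^\star$ (where $D^\lambda=0$ for $\lambda\notin\Gamma$) and $(E_c)_0^0=\mathcal L_0^0\oplus(D^0)^\star$. ''Extends'' means that the restriction to the subspace $\mathcal L\subseteq E_c$ is the given involution. *)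

(* Defs.v *)
From HB Require Import structures.
From mathcomp Require Import all_boot all_order all_algebra.
From mathcomp Require Import all_classical all_reals all_analysis.
From mathcomp Require Export complex.

Set Implicit Arguments.
Unset Strict Implicit.
Unset Printing Implicit Defensive.

Import Order.TTheory GRing.Theory Num.Theory.
Import numFieldNormedType.Exports.

Local Open Scope classical_set_scope.
Local Open Scope complex_scope.
Local Open Scope ring_scope.

Definition zsubmod (A : zmodType) (S : set A) : Prop :=
  S 0 /\ forall x y, S x -> S y -> S (x - y).

Definition zspan (A : zmodType) (S : set A) : set A := smallest (@zsubmod A) S.

Definition free_abelian_of_finite_rank (A : zmodType) : Prop :=
  exists (n : nat) (f : {additive A -> 'rV[int]_n}), bijective f.

Section LinearAlgebra.
Variables (K : fieldType) (M : lmodType K).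

Definition is_subspace (S : set M) : Prop :=
  S 0 /\ forall a x y, S x -> S y -> S (a *: x + y).

Definition lspan (S : set M) : set M := smallest is_subspace S.

Definition line (e : M) : set M := [set a *: e | a in setT].

Definition dim_le1 (S : set M) : Prop := exists e, S = line e.

Definition dim_eq1 (S : set M) : Prop := exists2 e, e != 0 & S = line e.

(* U is the internal direct sum of the subspaces S i, i ranging over J. *)
Record is_direct_sum (I : choiceType) (J : set I) (S : I -> set M) (U : set M)
    : Prop := IsDirectSum {
  ds_subspace : forall i, J i -> is_subspace (S i) ;
  ds_sum : U = [set x | exists (s : seq I) (f : I -> M),
    [/\ uniq s, forall i, i \in s -> J i /\ S i (f i)
      & x = \sum_(i <- s) f i]] ;
  ds_indep : forall (s : seq I) (f : I -> M), uniq s ->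
    (forall i, i \in s -> J i /\ S i (f i)) ->
    \sum_(i <- s) f i = 0 -> forall i, i \in s -> f i = 0 }.

Record lie_bracket (br : M -> M -> M) : Prop := LieBracket {
  lie_linearr : forall x, linear (br x) ;
  lie_linearl : forall y, linear (br^~ y) ;
  lie_alt : forall x, br x x = 0 ;
  lie_jacobi : forall x y z,
    br x (br y z) + br y (br z x) + br z (br x y) = 0 }.

Definition centerless (br : M -> M -> M) : Prop :=
  forall x, (forall y, br x y = 0) -> x = 0.

Definition centroid (br : M -> M -> M) : set (M -> M) :=
  [set c | linear c /\ forall x y, c (br x y) = br x (c y)].

(* U is a Lie algebra inside M under br, G its grading by Lam (the
   homogeneous spaces U^lam), and H the subspace on which the involution
   must act as -1; the values of tau off U are irrelevant. *)
Record chevalley_involution (Lam : zmodType) (U : set M) (br : M -> M -> M)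
    (G : Lam -> set M) (H : set M) (tau : M -> M) : Prop :=
  ChevalleyInvolution {
  chev_bij : set_bij U U tau ;
  chev_linear : forall a x y, U x -> U y ->
    tau (a *: x + y) = a *: tau x + tau y ;
  chev_bracket : forall x y, U x -> U y -> tau (br x y) = br (tau x) (tau y) ;
  chev_square : forall x, U x -> tau (tau x) = x ;
  chev_nontrivial : exists2 x, U x & tau x <> x ;
  chev_grading : forall lam, tau @` G lam = G (- lam) ;
  chev_cartan : forall h, H h -> tau h = - h }.

End LinearAlgebra.

(* Lie subalgebras of the associative algebra of maps L -> L under the
   commutator; the type of elements is given a vector space structure. *)
Record lieSubalg (K : fieldType) (L : lmodType K) := LieSubalg {
  subalg_pred :> {pred (L -> L)} ;
  subalg_submod : GRing.submod_closed subalg_pred ;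
  subalg_comm : forall d1 d2, d1 \in subalg_pred -> d2 \in subalg_pred ->
    (d1 \o d2) - (d2 \o d1) \in subalg_pred }.

HB.instance Definition _ (K : fieldType) (L : lmodType K) (D : lieSubalg L) :=
  GRing.isSubmodClosed.Build K (L -> L) (subalg_pred D) (subalg_submod D).

Record subalg_elt (K : fieldType) (L : lmodType K) (D : lieSubalg L) :=
  SubalgElt { elt_map :> L -> L ; eltP : elt_map \in subalg_pred D }.

Coercion subalg_elt : lieSubalg >-> Sortclass.

HB.instance Definition _ (K : fieldType) (L : lmodType K) (D : lieSubalg L) :=
  [isSub for @elt_map K L D].
HB.instance Definition _ (K : fieldType) (L : lmodType K) (D : lieSubalg L) :=
  [Choice of subalg_elt D by <:].
HB.instance Definition _ (K : fieldType) (L : lmodType K) (D : lieSubalg L) :=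
  [SubChoice_isSubLmodule of subalg_elt D by <:].

Definition commutator (K : fieldType) (L : lmodType K) (D : lieSubalg L)
    (d1 d2 : D) : D :=
  SubalgElt (subalg_comm (eltP d1) (eltP d2)).

Section RootSystem.
Variables (K : fieldType) (V : vectType K).
Variables (Delta : set V) (coroot : V -> {linear V -> K^o}).

Definition nonzero_roots : set V := [set a | Delta a /\ a != 0].

Definition indivisible_roots : set V :=
  [set a | a = 0 \/ nonzero_roots a /\ ~ Delta (2^-1 *: a)].

Definition root_lattice : set V := zspan Delta.

(* Root systems in the sense of Bourbaki (possibly non-reduced), with 0
   adjoined.  The coroots of a root system are determined by it, so carrying
   them as data is harmless; coroot a is meaningful for nonzero roots a only,
   and coroot a b is the Cartan integer <b, a^v>. *)
Record irreducible_root_system : Prop := IrreducibleRootSystem {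
  rs_finite : finite_set Delta ;
  rs_zero : Delta 0 ;
  rs_span : lspan Delta = setT ;
  rs_two : forall a, nonzero_roots a -> coroot a a = 2 ;
  rs_refl : forall a, nonzero_roots a ->
    [set b - coroot a b *: a | b in Delta] = Delta ;
  rs_int : forall a b, nonzero_roots a -> Delta b ->
    exists n : int, coroot a b = n%:~R ;
  rs_nonempty : nonzero_roots !=set0 ;
  rs_irreducible : forall A B : set V, A `|` B = nonzero_roots ->
    (forall a b, A a -> B b -> coroot a b = 0 /\ coroot b a = 0) ->
    A = set0 \/ B = set0 }.

End RootSystem.

Section LieTorus.
Variables (R : realType).
Local Notation K := R[i].
Variables (Lam : zmodType) (V : vectType K).
Variables (Delta : set V) (coroot : V -> {linear V -> K^o}).
Variables (L : lmodType K) (br : L -> L -> L) (Lg : V -> Lam -> set L).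

(* Lg a lam is the homogeneous space of degree (a, lam) for a in the root
   lattice Q; its values for a outside Q are never used. *)
Record lie_torus : Prop := LieTorus {
  torus_lie : lie_bracket br ;
  torus_direct : is_direct_sum (root_lattice Delta `*` [set: Lam])
    (fun i => Lg i.1 i.2) [set: L] ;
  torus_graded : forall a b lam mu x y,
    root_lattice Delta a -> root_lattice Delta b ->
    Lg a lam x -> Lg b mu y -> Lg (a + b) (lam + mu) (br x y) ;
  torus_LT1 : forall a lam, root_lattice Delta a -> ~ Delta a ->
    Lg a lam = [set 0] ;
  torus_LT2_dim : forall a lam, nonzero_roots Delta a -> dim_le1 (Lg a lam) ;
  torus_LT2_ind : forall a, nonzero_roots Delta a -> indivisible_roots Delta a ->
    dim_eq1 (Lg a 0) ;
  torus_LT2_sl2 : forall a lam, nonzero_roots Delta a -> dim_eq1 (Lg a lam) ->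
    exists e f, [/\ Lg a lam = line e, Lg (- a) (- lam) = line f
      & forall b mu x, Delta b -> Lg b mu x ->
          br (br e f) x = coroot a b *: x] ;
  torus_LT3 : forall lam, Lg 0 lam =
    lspan [set z | exists a mu x y, [/\ nonzero_roots Delta a, Lg a mu x,
      Lg (- a) (lam - mu) y & z = br x y]] ;
  torus_LT4 : zspan [set lam | exists2 a, Delta a & Lg a lam <> [set 0]]
    = [set: Lam] }.

(* The homogeneous space L^lam, the sum over a of Lg a lam. *)
Definition torus_deg (lam : Lam) : set L :=
  lspan (\bigcup_(a in root_lattice Delta) Lg a lam).

Record centroid_basis (Gam : set Lam) (chi : Lam -> L -> L) : Prop :=
  CentroidBasis {
  cb_subgroup : zsubmod Gam ;
  cb_neq0 : forall mu, Gam mu -> chi mu <> 0 ;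
  cb_direct : is_direct_sum Gam (fun mu => line (chi mu)) (centroid br) ;
  cb_degree : forall mu lam x, Gam mu -> torus_deg lam x ->
    torus_deg (lam + mu) (chi mu x) ;
  cb_mul : forall mu nu, Gam mu -> Gam nu ->
    chi mu \o chi nu = chi (mu + nu) }.

Record graded_invariant_form (frm : L -> L -> K^o) : Prop :=
  GradedInvariantForm {
  gf_linearr : forall x, linear (frm x) ;
  gf_linearl : forall y, linear (frm^~ y) ;
  gf_sym : forall x y, frm x y = frm y x ;
  gf_invariant : forall x y z, frm (br x y) z = frm x (br y z) ;
  gf_nondegenerate : forall x, (forall y, frm x y = 0) -> x = 0 ;
  gf_graded : forall lam mu x y, torus_deg lam x -> torus_deg mu y ->
    lam + mu != 0 -> frm x y = 0 }.

(* del is the derivation multiplying L^lam by theta lam. *)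
Definition is_degree_der (theta : Lam -> K) (del : L -> L) : Prop :=
  linear del /\ forall lam x, torus_deg lam x -> del x = theta lam *: x.

Variables (Gam : set Lam) (chi : Lam -> L -> L).

Definition SCDer_deg (mu : Lam) : set (L -> L) :=
  [set d | exists (theta : {additive Lam -> K}) (del : L -> L),
    [/\ is_degree_der theta del, theta mu = 0 & d = chi mu \o del]].

Definition SCDer : set (L -> L) := lspan (\bigcup_(mu in Gam) SCDer_deg mu).

Variable D : lieSubalg L.

Definition subalg_deg (mu : Lam) : set D :=
  [set d : D | SCDer_deg mu (elt_map d)].

(* The additive map theta with d = \partial_theta; it is unique since the
   degrees occurring in L generate Lam. *)
Definition degree_map (d : L -> L) : Lam -> K :=
  xget (fun=> 0) [set theta | zmod_morphism theta /\ is_degree_der theta d].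

(* D^0 is finite-dimensional, so the topology of pointwise convergence induces
   on (D^0)^* its unique Hausdorff vector space topology. *)
Definition ev (lam : Lam) : {ptws set_type (subalg_deg 0) -> K^o} :=
  fun d => degree_map (elt_map (set_val d)) lam.

Record permissible : Prop := Permissible {
  perm_sub : [set` subalg_pred D] `<=` SCDer ;
  perm_graded : is_direct_sum Gam subalg_deg [set: D] ;
  perm_inj : injective ev ;
  perm_discrete : isolated (range ev) = range ev }.

(* (D^mu)^*, extended by zero to the other D^nu; it is 0 for mu not in Gam. *)
Definition dual_deg (mu : Lam) : set (D -> K^o) :=
  [set phi | linear phi /\
    forall nu d, Gam nu -> nu != mu -> subalg_deg nu d -> phi d = 0].

Definition graded_dual : set (D -> K^o) :=
  lspan (\bigcup_(mu in Gam) dual_deg mu).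

Definition dual_act (d : D) (phi : D -> K^o) : D -> K^o :=
  fun d' => phi (commutator d' d).

Record affine_cocycle (kappa : D -> D -> D -> K^o) : Prop := AffineCocycle {
  ac_dual : forall d1 d2, graded_dual (kappa d1 d2) ;
  ac_linearr : forall d, linear (kappa d) ;
  ac_linearl : forall d, linear (kappa^~ d) ;
  ac_alt : forall d, kappa d d = 0 ;
  ac_cocycle : forall d1 d2 d3,
    kappa (commutator d1 d2) d3 + kappa (commutator d2 d3) d1
      + kappa (commutator d3 d1) d2
    = dual_act d1 (kappa d2 d3) + dual_act d2 (kappa d3 d1)
      + dual_act d3 (kappa d1 d2) ;
  ac_graded : forall mu1 mu2 d1 d2, Gam mu1 -> Gam mu2 ->
    subalg_deg mu1 d1 -> subalg_deg mu2 d2 ->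
    dual_deg (- mu1 - mu2) (kappa d1 d2) ;
  ac_cyclic : forall d1 d2 d3, kappa d1 d2 d3 = kappa d2 d3 d1 ;
  ac_zero : forall d1 d2, subalg_deg 0 d1 -> kappa d1 d2 = 0 }.

Variables (frm : L -> L -> K^o) (kappa : D -> D -> D -> K^o).

Definition sigma_D (x y : L) : D -> K^o := fun d => frm (elt_map d x) y.

(* E is the subspace of triples (x, c, d) with c in the graded dual of D;
   the formula for its bracket makes sense for arbitrary functions c. *)
Definition E_ambient : lmodType K := (L * (D -> K^o) * D)%type.

Definition E_bracket (X Y : E_ambient) : E_ambient :=
  let: (x1, c1, d1) := X in
  let: (x2, c2, d2) := Y in
  (br x1 x2 + elt_map d1 x2 - elt_map d2 x1,
   sigma_D x1 x2 + dual_act d1 c2 - dual_act d2 c1 + kappa d1 d2,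
   commutator d1 d2).

Definition E_core : set E_ambient :=
  [set X | graded_dual X.1.2 /\ X.2 = 0].

Definition E_core_deg (lam : Lam) : set E_ambient :=
  [set X | [/\ torus_deg lam X.1.1, dual_deg (- lam) X.1.2 & X.2 = 0]].

(* (E_c)_0^0 *)
Definition E_core_cartan : set E_ambient :=
  [set X | [/\ Lg 0 0 X.1.1, dual_deg 0 X.1.2 & X.2 = 0]].

End LieTorus.

Arguments subalg_deg {R Lam V} Delta {L} Lg chi D mu.
Arguments E_core {R Lam V} Delta {L} Lg Gam chi D.
Arguments E_core_deg {R Lam V} Delta {L} Lg Gam chi D lam.
Arguments E_core_cartan {R Lam V} Delta {L} Lg Gam chi D.

(* Main.v *)
Require Import Defs.
From HB Require Import structures.
From mathcomp Require Import all_boot all_order all_algebra.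
From mathcomp Require Import all_classical all_reals all_analysis.
From mathcomp Require Import complex.
Import Order.TTheory GRing.Theory Num.Theory.
Import numFieldNormedType.Exports.
Local Open Scope classical_set_scope.
Local Open Scope complex_scope.
Local Open Scope ring_scope.

(** A Chevalley involution [tau] of [L] acts by conjugation on the maps
    [L -> L], and dually on the functionals on [D] as soon as [D] is stable
    under this conjugation.  The extension to the core is
    [x + c |-> tau x + c \o (d |-> tau d tau)].

    The core consists of elements without [D]-component, so its bracket
    reduces to [[x1, x2] + sigma_D x1 x2], with the second factor central
    ([E_bracket_core]), and the only nontrivial compatibility is
    [(d (tau x), tau y) = (tau (d (tau x)), y)], that is, invariance of the
    form under [tau].  It holds because an invariant graded form on a Lie torus
    is determined by its restriction to [L_0^0] ([form_eq0]), where [tau] is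
    [-1] ([form_tau]).

    As for the action on [D], conjugation by [tau] changes the sign of the
    degree derivations, and it maps [chi^mu] to a multiple of [chi^(-mu)],
    the conjugate being a homogeneous element of the centroid of degree [-mu]
    ([conj_chi]).  So it exchanges the components of degrees [mu] and [-mu] of
    SCDer ([conj_SCDer_deg]), which makes SCDer itself stable, and it is [-1]
    in degree 0 because [chi^0] is the identity ([conj_SCDer_deg0]), which
    makes any [D] concentrated in degree 0 stable.  The latter also gives the
    sign [-1] on [(D^0)^*] required of a Chevalley involution of the core. *)

Set Implicit Arguments.
Unset Strict Implicit.
Unset Printing Implicit Defensive.

(** * Linear maps and spans *)

Section Linear.
Variables (K : fieldType) (M N : lmodType K).

Lemma linear_fun0 (f : M -> N) : linear f -> f 0 = 0.
Proof. by move=> hf; have := hf (-1) 0 0; rewrite scaler0 addr0 scaleN1r addNr. Qed.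

Lemma linear_funZ (f : M -> N) : linear f -> forall a x, f (a *: x) = a *: f x.
Proof. by move=> hf a x; have := hf a x 0; rewrite linear_fun0 // !addr0. Qed.

Lemma linear_funN (f : M -> N) : linear f -> forall x, f (- x) = - f x.
Proof. by move=> hf x; rewrite -scaleN1r linear_funZ // scaleN1r. Qed.

Lemma linear_fun_sum (f : M -> N) : linear f ->
  forall (I : Type) (s : seq I) (P : pred I) (F : I -> M),
  f (\sum_(i <- s | P i) F i) = \sum_(i <- s | P i) f (F i).
Proof.
move=> hf I s P F; apply: (big_morph f _ (linear_fun0 hf)) => x y.
by rewrite -(scale1r x) hf !scale1r.
Qed.

Lemma subset_lspan (S : set M) : S `<=` lspan S.
Proof. exact: sub_smallest. Qed.

Lemma lspan_subset (S T : set M) : is_subspace T -> S `<=` T -> lspan S `<=` T.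
Proof. by move=> hT ST; apply: smallest_sub. Qed.

Lemma is_subspace_lspan (S : set M) : is_subspace (lspan S).
Proof.
split=> [T [[]] //|a x y Sx Sy T TS].
by case: (TS) => -[_ hT] _; apply: hT; [exact: Sx | exact: Sy].
Qed.

Lemma is_subspace_eq (f g : M -> N) : linear f -> linear g ->
  is_subspace [set x | f x = g x].
Proof.
move=> hf hg; split=> /= [|a x y fx fy]; first by rewrite !linear_fun0.
by rewrite hf hg fx fy.
Qed.

Lemma linear_zero : linear (fun _ : M => 0 : N).
Proof. by move=> a x y; rewrite scaler0 addr0. Qed.

Lemma is_subspace_linear : is_subspace [set f : M -> N | linear f].
Proof.
split=> [a x y|a f g hf hg k x y]; first exact: linear_zero.
rewrite -[LHS]/(a *: f (k *: x + y) + g (k *: x + y)).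
rewrite -[RHS]/(k *: (a *: f x + g x) + (a *: f y + g y)).
by rewrite hf hg !scalerDr !scalerA addrACA (mulrC a).
Qed.

Lemma linear_eq_direct_sum (I : choiceType) (J : set I) (S : I -> set M)
    (f g : M -> N) : is_direct_sum J S [set: M] -> linear f -> linear g ->
  (forall i x, J i -> S i x -> f x = g x) -> forall x, f x = g x.
Proof.
move=> hS hf hg fg x; have : [set: M] x by [].
rewrite (ds_sum hS) => -[s [F [_ sF ->]]].
rewrite !linear_fun_sum //; apply: eq_big_seq => i /sF[Ji SF].
exact: fg SF.
Qed.

End Linear.

Lemma lspan_image (K : fieldType) (M N : lmodType K) (f : M -> N)
    (S : set M) (T : set N) : linear f -> (forall x, S x -> T (f x)) ->
  forall x, lspan S x -> lspan T (f x).
Proof.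
move=> hf ST; have [T0 TP] := is_subspace_lspan T.
apply: (lspan_subset (T := [set x | lspan T (f x)])) => [|x /ST Tfx].
  split=> /= [|a x y hx hy]; first by rewrite linear_fun0.
  by rewrite hf; apply: TP.
exact: subset_lspan.
Qed.

(** * Gradings of a Lie torus *)

Section Torus.
Variables (R : realType).
Local Notation K := R[i].
Variables (Lam : zmodType) (V : vectType K).
Variables (Delta : set V) (coroot : V -> {linear V -> K^o}).
Variables (L : lmodType K) (br : L -> L -> L) (Lg : V -> Lam -> set L).
Hypothesis hDelta : irreducible_root_system Delta coroot.
Hypothesis hL : lie_torus Delta coroot br Lg.

Local Notation deg := (torus_deg Delta Lg).

Lemma root_lattice_root a : Delta a -> root_lattice Delta a.
Proof. by move=> ha T [_ DT]; apply: DT. Qed.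

Lemma root_latticeB a b : root_lattice Delta a -> root_lattice Delta b ->
  root_lattice Delta (a - b).
Proof.
move=> ha hb T TS; case: (TS) => -[_ hT] _.
by apply: hT; [exact: ha | exact: hb].
Qed.

Lemma root_lattice0 : root_lattice Delta 0.
Proof. exact: root_lattice_root (rs_zero hDelta). Qed.

Lemma root_latticeN a : root_lattice Delta a -> root_lattice Delta (- a).
Proof. by move=> ha; rewrite -sub0r; apply: root_latticeB ha; exact: root_lattice0. Qed.

Lemma root_latticeD a b : root_lattice Delta a -> root_lattice Delta b ->
  root_lattice Delta (a + b).
Proof. by move=> ha hb; rewrite -[b]opprK; apply: root_latticeB ha (root_latticeN hb). Qed.

Lemma torus_deg_homogeneous a lam x :
  root_lattice Delta a -> Lg a lam x -> deg lam x.
Proof. by move=> ha hx; apply: subset_lspan; exists a. Qed.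

Lemma linear_eq_homogeneous (N : lmodType K) (f g : L -> N) :
  linear f -> linear g ->
  (forall a lam x, root_lattice Delta a -> Lg a lam x -> f x = g x) ->
  forall x, f x = g x.
Proof.
move=> hf hg fg; apply: (linear_eq_direct_sum (torus_direct hL)) => //.
by case=> a lam x [/= ha _]; apply: fg.
Qed.

Lemma linear_eq_deg (N : lmodType K) (f g : L -> N) :
  linear f -> linear g -> (forall lam x, deg lam x -> f x = g x) ->
  forall x, f x = g x.
Proof.
move=> hf hg fg; apply: linear_eq_homogeneous => // a lam x ha hx.
exact: fg (torus_deg_homogeneous ha hx).
Qed.

(** Axiom (LT2) provides some basis vector [e] of the root space; rescaling its
    partner allows [x] itself to be the first member of the sl2-pair. *)
Lemma root_sl2_partner a lam x : nonzero_roots Delta a -> Lg a lam x ->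
  x != 0 -> exists2 f, Lg 0 0 (br x f) &
    forall b mu y, Delta b -> Lg b mu y -> br (br x f) y = coroot a b *: y.
Proof.
move=> ha hx x0; have [e0 he0] := torus_LT2_dim hL lam ha.
have hdim : dim_eq1 (Lg a lam).
  exists e0 => //; apply: contraNneq x0 => e00.
  by move: hx; rewrite he0 => -[c _ <-]; rewrite e00 scaler0.
have [e [f [he hf hact]]] := torus_LT2_sl2 hL ha hdim.
move: hx; rewrite he => -[c _ cx].
have c0 : c != 0 by apply: contraNneq x0 => c00; rewrite -cx c00 scale0r.
have brE : br x (c^-1 *: f) = br e f.
  rewrite -cx (linear_funZ (lie_linearl (torus_lie hL) _)).
  by rewrite (linear_funZ (lie_linearr (torus_lie hL) _)) scalerA divff // scale1r.
exists (c^-1 *: f); last by move=> b mu y hb hy; rewrite brE; apply: hact hy.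
have ra := root_lattice_root ha.1.
rewrite brE -(subrr a) -(subrr lam).
apply: (torus_graded hL ra (root_latticeN ra)).
  by rewrite he; exists 1; rewrite ?scale1r.
by rewrite hf; exists 1; rewrite ?scale1r.
Qed.

(** * Invariant forms are determined on the Cartan subalgebra *)

Section InvariantForm.
Variable B : L -> L -> K^o.
Hypothesis B_linearr : forall x, linear (B x).
Hypothesis B_linearl : forall y, linear (B^~ y).
Hypothesis B_invariant : forall x y z, B (br x y) z = B x (br y z).
Hypothesis B_graded : forall lam mu x y, deg lam x -> deg mu y ->
  lam + mu != 0 -> B x y = 0.
Hypothesis B_cartan : forall h h', Lg 0 0 h -> Lg 0 0 h' -> B h h' = 0.

Let double_eq0 (t : K) : 2 * t = 0 -> t = 0.
Proof. by move/eqP; rewrite mulf_eq0 pnatr_eq0 /= => /eqP. Qed.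

(** A nonzero [z] of degree [(b, 0)], [b != 0], is half of [[h', z]] for the
    coroot element [h'] of [b], and invariance moves [h'] onto [h]. *)
Lemma form_cartan_degree0 h b z :
  Lg 0 0 h -> (forall h', Lg 0 0 h' -> br h h' = 0) ->
  root_lattice Delta b -> Lg b 0 z -> B h z = 0.
Proof.
move=> h0 hC hb hz.
have [b0|b0] := eqVneq b 0; first by apply: B_cartan; rewrite // -b0.
have [->|z0] := eqVneq z 0; first by rewrite (linear_fun0 (B_linearr _)).
have [Db|nDb] := pselect (Delta b); last first.
  by move: hz z0; rewrite (torus_LT1 hL) // => -> /eqP.
have hb' : nonzero_roots Delta b by [].
have [f h'0 hact] := root_sl2_partner hb' hz z0.
apply: double_eq0.
have -> : 2 * B h z = B h (br (br z f) z).
  rewrite (hact _ _ _ Db hz) (rs_two hDelta hb').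
  by rewrite (linear_funZ (B_linearr _)).
by rewrite -B_invariant hC // (linear_fun0 (B_linearl _)).
Qed.

(** With [h = [x, f]] the coroot element of [x], invariance gives
    [2 B(x, y) = B([h, x], y) = B(h, [x, y])], and for [y] homogeneous
    [[x, y]] may be taken of degree 0 in [Lam], as [B] is graded. *)
Lemma form_root_eq0 a lam x y :
  nonzero_roots Delta a -> Lg a lam x -> B x y = 0.
Proof.
move=> ha hx; have ra := root_lattice_root ha.1.
have [->|x0] := eqVneq x 0; first by rewrite (linear_fun0 (B_linearl _)).
have [f h0 hact] := root_sl2_partner ha hx x0.
apply: (linear_eq_homogeneous (B_linearr x) (@linear_zero _ L K^o)) => b mu {}y hb hy.
have [lm|lm] := eqVneq (lam + mu) 0; last first.
  exact: B_graded (torus_deg_homogeneous ra hx) (torus_deg_homogeneous hb hy) lm.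
apply: double_eq0.
have -> : 2 * B x y = B (br (br x f) x) y.
  rewrite (hact _ _ _ ha.1 hx) (rs_two hDelta ha).
  by rewrite (linear_funZ (B_linearl _)).
rewrite B_invariant.
apply: (form_cartan_degree0 h0 _ (root_latticeD ra hb)).
  by move=> h' h'0; rewrite (hact _ _ _ (rs_zero hDelta) h'0) linear0 scale0r.
by rewrite -lm; apply: (torus_graded hL).
Qed.

(** Root spaces lie in the radical of [B]; hence so does [L_0^lam], which by
    (LT3) is spanned by brackets [[u, v]] of root vectors, since
    [B([u, v], y) = B(u, [v, y])]. *)
Lemma form_eq0 x y : B x y = 0.
Proof.
apply: (linear_eq_homogeneous (B_linearl y) (@linear_zero _ L K^o)) => a lam {}x ra hx.
have [a0|a0] := eqVneq a 0; last first.
  have [Da|nDa] := pselect (Delta a); first exact: form_root_eq0 hx.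
  by move: hx; rewrite (torus_LT1 hL) // => ->; rewrite (linear_fun0 (B_linearl _)).
move: hx; rewrite a0 (torus_LT3 hL).
apply: (lspan_subset (is_subspace_eq (B_linearl y) (@linear_zero _ L K^o))).
move=> _ [b [mu [u [v [hb hu _ ->]]]]] /=.
by rewrite B_invariant; apply: form_root_eq0 hu.
Qed.

End InvariantForm.

(** * Homogeneous elements of the centroid *)

Variable frm : L -> L -> K^o.
Hypothesis hfrm : graded_invariant_form Delta br Lg frm.

(** The sum of the spaces [L^lam] is direct: pairing with [L^(-lam)] through the
    nondegenerate graded form isolates the component of degree [lam]. *)
Lemma deg_component (I : eqType) (s : seq I) (g : I -> Lam) (f : I -> L) mu :
  (forall i, i \in s -> deg (g i) (f i)) -> deg mu (\sum_(i <- s) f i) ->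
  \sum_(i <- s) f i = \sum_(i <- s | g i == mu) f i.
Proof.
move=> sf sumd; apply/eqP; rewrite -subr_eq0; apply/eqP.
rewrite [X in _ - X]big_mkcond -sumrB /=.
set F := fun i => f i - (if g i == mu then f i else 0).
apply: (gf_nondegenerate hfrm).
apply: (linear_eq_deg (gf_linearr hfrm _) (@linear_zero _ L K^o)) => nu y hy.
have [mn|mn] := eqVneq (mu + nu) 0.
  rewrite (linear_fun_sum (gf_linearl hfrm y)) big1_seq // => i /andP[_ si].
  rewrite /F; case: eqVneq => gi.
    by rewrite subrr (linear_fun0 (gf_linearl hfrm _)).
  rewrite subr0; apply: (gf_graded hfrm (sf _ si) hy).
  by apply: contra gi => /eqP gn; apply/eqP/(addIr nu); rewrite gn mn.
rewrite /F sumrB -big_mkcond /= -scaleN1r addrC (gf_linearl hfrm y).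
rewrite (gf_graded hfrm sumd hy mn) addr0 /=.
rewrite (linear_fun_sum (gf_linearl hfrm y)) /= big1_seq ?scaler0 // => i.
by move=> /andP[/eqP gi si]; apply: (gf_graded hfrm (sf _ si) hy); rewrite gi.
Qed.

Variables (Gam : set Lam) (chi : Lam -> L -> L).
Hypothesis hchi : centroid_basis Delta br Lg Gam chi.

Lemma Gam0 : Gam 0.
Proof. by case: (cb_subgroup hchi). Qed.

Lemma GamN mu : Gam mu -> Gam (- mu).
Proof. by case: (cb_subgroup hchi) => G0 GB hmu; rewrite -sub0r; apply: GB. Qed.

Lemma centroid_chi mu : Gam mu -> centroid br (chi mu).
Proof.
move=> hmu; rewrite (ds_sum (cb_direct hchi)).
exists [:: mu], chi; split=> // [i|]; last by rewrite big_seq1.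
by rewrite inE => /eqP ->; split=> //; exists 1; rewrite ?scale1r.
Qed.

Lemma linear_chi mu : Gam mu -> linear (chi mu).
Proof. by move=> /centroid_chi[]. Qed.

Lemma centroid_expansion c : centroid br c ->
  exists (s : seq Lam) (t : Lam -> K), (forall mu, mu \in s -> Gam mu) /\
    forall x, c x = \sum_(mu <- s) t mu *: chi mu x.
Proof.
rewrite (ds_sum (cb_direct hchi)) => -[s [F [us sF ->]]].
have /choice[t tE] : forall mu, exists t, mu \in s -> F mu = t *: chi mu.
  move=> mu; have [/sF[_ [t _ <-]]|] := boolP (mu \in s); last by exists 0.
  by exists t.
exists s, t; split=> [mu /sF[] //|x].
by rewrite fct_sumE; apply: eq_big_seq => mu smu; rewrite tE.
Qed.

(** [chi 0] is a unit for all [chi mu], and the identity is one of their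
    combinations. *)
Lemma chi0 x : chi 0 x = x.
Proof.
have cid : centroid br id by split.
have [s [t [sG idE]]] := centroid_expansion cid.
rewrite [x in chi 0 x]idE [RHS]idE (linear_fun_sum (linear_chi Gam0)).
apply: eq_big_seq => mu /sG hmu.
rewrite (linear_funZ (linear_chi Gam0)).
by rewrite -[chi 0 (chi mu x)]/((chi 0 \o chi mu) x) (cb_mul hchi Gam0 hmu) add0r.
Qed.

Lemma degZ lam a x : deg lam x -> deg lam (a *: x).
Proof.
have [d0 dP] : is_subspace (deg lam) by exact: is_subspace_lspan.
by move=> hx; rewrite -[a *: x]addr0; apply: dP.
Qed.

(** Comparing components of degree [lam + mu] on [L^lam] kills every term of the
    expansion of [c] except the one in [chi mu]. *)
Lemma centroid_homogeneous mu c : Gam mu -> centroid br c ->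
  (forall lam x, deg lam x -> deg (lam + mu) (c x)) ->
  exists a, forall x, c x = a *: chi mu x.
Proof.
move=> hmu hc cdeg; have [s [t [sG cE]]] := centroid_expansion hc.
exists (\sum_(nu <- s | nu == mu) t nu).
have cl := linear_chi hmu.
apply: linear_eq_deg; first by case: hc.
  by move=> k u v /=; rewrite cl scalerDr !scalerA mulrC.
move=> lam x hx; have := cdeg _ _ hx; rewrite cE => hs.
rewrite (deg_component (g := fun nu => lam + nu) _ hs); last first.
  by move=> nu /sG hnu; apply: degZ; apply: (cb_degree hchi).
rewrite scaler_suml; apply: eq_big => [nu|nu].
  by rewrite (inj_eq (addrI lam)).
by move=> /eqP/addrI ->.
Qed.

(** * Conjugation by a Chevalley involution *)

Variable tau : L -> L.
Hypothesis htau :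
  chevalley_involution [set: L] br (torus_deg Delta Lg) (Lg 0 0) tau.

Local Notation SCDeg := (SCDer_deg Delta Lg chi).

Lemma tauK x : tau (tau x) = x.
Proof. exact: (chev_square htau). Qed.

Lemma linear_tau : linear tau.
Proof. by move=> a x y; apply: (chev_linear htau). Qed.

Lemma tau_bracket x y : tau (br x y) = br (tau x) (tau y).
Proof. exact: (chev_bracket htau). Qed.

Lemma tau_deg lam x : deg lam x -> deg (- lam) (tau x).
Proof. by move=> hx; rewrite -(chev_grading htau); exists x. Qed.

Lemma linear_conj (f : L -> L) : linear f -> linear (tau \o f \o tau).
Proof. by move=> hf a x y; rewrite /= linear_tau hf linear_tau. Qed.

(** The difference of the two sides is an invariant graded form which vanishes
    on [L_0^0], where [tau] is [-1]. *)
Lemma form_tau x y : frm (tau x) (tau y) = frm x y.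
Proof.
apply/eqP; rewrite -subr_eq0; apply/eqP.
have flr := gf_linearr hfrm; have fll := gf_linearl hfrm.
apply: (form_eq0 (B := fun x y => frm (tau x) (tau y) - frm x y)).
- move=> {}x a u v /=.
  by rewrite linear_tau !flr scalerBr opprD addrACA.
- move=> {}y a u v /=.
  by rewrite linear_tau !fll scalerBr opprD addrACA.
- by move=> {}x {}y z; rewrite !tau_bracket !(gf_invariant hfrm).
- move=> lam mu {}x {}y hx hy lm.
  rewrite (gf_graded hfrm hx hy lm) (gf_graded hfrm (tau_deg hx) (tau_deg hy)) ?subr0 //.
  by rewrite -opprD oppr_eq0.
- move=> h h' hh hh'; rewrite !(chev_cartan htau) //.
  by rewrite (linear_funN (flr _)) (linear_funN (fll _)) opprK subrr.
Qed.

Lemma conj_centroid c : centroid br c -> centroid br (tau \o c \o tau).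
Proof.
move=> [cl cbr]; split; first exact: linear_conj.
by move=> x y /=; rewrite tau_bracket cbr tau_bracket tauK.
Qed.

Lemma conj_chi mu : Gam mu ->
  exists a, forall x, tau (chi mu (tau x)) = a *: chi (- mu) x.
Proof.
move=> hmu; apply: (centroid_homogeneous (GamN hmu) (conj_centroid (centroid_chi hmu))).
move=> lam x hx; rewrite -[lam]opprK -opprD.
by apply: tau_deg; apply: (cb_degree hchi hmu); apply: tau_deg.
Qed.

(** The conjugate of [chi^mu \o del_theta] is
    [(a chi^(-mu)) \o del_(- theta)], [a] being the scalar of [conj_chi]; it is
    rewritten as [chi^(-mu) \o del_(- a theta)]. *)
Lemma conj_SCDer_deg mu d : Gam mu -> SCDeg mu d -> SCDeg (- mu) (tau \o d \o tau).
Proof.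
move=> hmu [theta [del [[dl dE] th0 ->]]]; have [a aE] := conj_chi hmu.
have cl := linear_chi (GamN hmu).
exists (a \*o (theta \o -%R)), (a *: (tau \o del \o tau)); split.
- split=> [k x y|lam x hx].
    rewrite -[LHS]/(a *: (tau \o del \o tau) (k *: x + y)) (linear_conj dl).
    by rewrite scalerDr scalerA mulrC -scalerA.
  rewrite -[LHS]/(a *: tau (del (tau x))) (dE _ _ (tau_deg hx)).
  by rewrite (linear_funZ linear_tau) tauK scalerA.
- by rewrite /= opprK th0 mulr0.
- apply: funext => x /=.
  rewrite -[X in chi (- mu) X]/(a *: tau (del (tau x))) (linear_funZ cl) -aE.
  by rewrite tauK.
Qed.

Lemma conj_SCDer_deg0 d x : SCDeg 0 d -> tau (d (tau x)) = - d x.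
Proof.
move=> [theta [del [[dl dE] _ ->]]] /=; rewrite !chi0.
have ol : linear (fun x => - del x).
  by move=> a u v /=; rewrite dl opprD scalerN.
apply: (linear_eq_deg (linear_conj dl) ol) => lam {}x hx /=.
rewrite (dE _ _ (tau_deg hx)) (dE _ _ hx) (linear_funZ linear_tau) tauK.
by rewrite raddfN scaleNr.
Qed.

Lemma linear_SCDer d : SCDer Delta Lg Gam chi d -> linear d.
Proof.
apply: (lspan_subset (T := [set d | linear d])) => [|_ [mu hmu [theta [del [[dl _] _ ->]]]]].
  exact: is_subspace_linear.
by move=> a x y /=; rewrite dl (linear_chi hmu).
Qed.

Lemma conj_SCDer d : SCDer Delta Lg Gam chi d ->
  SCDer Delta Lg Gam chi (tau \o d \o tau).
Proof.
have conj_lin : linear (fun d : L -> L => tau \o d \o tau).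
  by move=> a f g; apply: funext => x; apply: linear_tau.
apply: (lspan_image conj_lin) => {}d [mu hmu hd].
exists (- mu); first exact: GamN.
exact: conj_SCDer_deg.
Qed.

(** * The involution of the core *)

Section Core.
Variable D : lieSubalg L.
Hypothesis hD : permissible Delta Lg Gam chi D.
Hypothesis D_conj : forall d, d \in subalg_pred D -> tau \o d \o tau \in subalg_pred D.

Local Notation Ddeg := (subalg_deg Delta Lg chi D).
Local Notation dual := (dual_deg Delta Lg Gam chi (D := D)).
Local Notation gdual := (graded_dual Delta Lg Gam chi (D := D)).

Definition conj_elt (d : D) : D := SubalgElt (D_conj (eltP d)).

Lemma conj_eltK : involutive conj_elt.
Proof. by move=> d; apply: val_inj; apply: funext => x /=; rewrite !tauK. Qed.

Lemma linear_conj_elt : linear conj_elt.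
Proof. by move=> a d e; apply: val_inj; apply: funext => x; apply: linear_tau. Qed.

Lemma linear_elt (d : D) : linear (elt_map d).
Proof. by apply: linear_SCDer; apply: (perm_sub hD); apply: eltP. Qed.

Lemma conj_elt_deg mu d : Gam mu -> Ddeg mu d -> Ddeg (- mu) (conj_elt d).
Proof. exact: conj_SCDer_deg. Qed.

Lemma conj_elt_deg0 d : Ddeg 0 d -> conj_elt d = - d.
Proof.
by move=> hd; apply: val_inj; apply: funext => x; apply: conj_SCDer_deg0.
Qed.

Lemma dual_deg_conj mu phi : dual mu phi -> dual (- mu) (phi \o conj_elt).
Proof.
move=> [pl p0]; split=> [a d e|nu d hnu nm hd].
  by rewrite /= linear_conj_elt pl.
apply: (p0 (- nu)); [exact: GamN| |exact: conj_elt_deg].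
by rewrite eqr_oppLR.
Qed.

Lemma graded_dual_conj phi : gdual phi -> gdual (phi \o conj_elt).
Proof.
have conj_lin : linear (fun phi : D -> K^o => phi \o conj_elt) by [].
apply: (lspan_image conj_lin) => {}phi [mu hmu hphi].
by exists (- mu); [exact: GamN | exact: dual_deg_conj].
Qed.

Lemma linear_graded_dual phi : gdual phi -> linear phi.
Proof.
apply: (lspan_subset (T := [set phi | linear phi])) => [|_ [mu _ []] //].
exact: is_subspace_linear.
Qed.

(** Both sides vanish on [D^mu] for [mu != 0], and conjugation is [-1] on
    [D^0]. *)
Lemma dual_deg0_conj phi : dual 0 phi -> phi \o conj_elt = - phi.
Proof.
move=> [pl p0]; apply: funext.
apply: (linear_eq_direct_sum (perm_graded hD)).
- by move=> a d e /=; rewrite linear_conj_elt pl.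
- by move=> a d e; rewrite -[LHS]/(- phi (a *: d + e)) pl opprD -scalerN.
move=> mu d hmu hd; rewrite /= -[RHS]/(- phi d).
have [mu0|mu0] := eqVneq mu 0.
  by rewrite conj_elt_deg0 ?(linear_funN pl) // -mu0.
rewrite (p0 _ _ hmu mu0 hd) oppr0.
by rewrite (p0 (- mu) _ (GamN hmu) _ (conj_elt_deg hmu hd)) // oppr_eq0.
Qed.

Variable kappa : D -> D -> D -> K^o.
Hypothesis hkappa : affine_cocycle Delta Lg Gam chi kappa.

Local Notation E := (E_ambient D).
Local Notation core := (E_core Delta Lg Gam chi D).

Definition core_involution (X : E) : E := (tau X.1.1, X.1.2 \o conj_elt, X.2).

Lemma commutator0r (d : D) : commutator d 0 = 0.
Proof.
apply: val_inj; apply: funext => x.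
rewrite -[LHS]/(elt_map d 0 - 0) (linear_fun0 (linear_elt d)).
exact: subr0.
Qed.

Lemma E_bracket_core x1 c1 x2 c2 : gdual c1 -> gdual c2 ->
  E_bracket br frm kappa (x1, c1, 0) (x2, c2, 0) =
  (br x1 x2, sigma_D frm x1 x2, 0).
Proof.
move=> h1 h2; rewrite /E_bracket (ac_alt hkappa) commutator0r addr0.
have act0 c : gdual c -> dual_act (0 : D) c = 0.
  move=> /linear_graded_dual cl; apply: funext => d.
  by rewrite /dual_act commutator0r (linear_fun0 cl).
by rewrite !act0 // !subr0 !addr0.
Qed.

Lemma core_involutionK : involutive core_involution.
Proof.
move=> [[x c] d]; rewrite /core_involution /= tauK -compA.
by congr (_, _, _); apply: funext => e /=; rewrite conj_eltK.
Qed.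

Lemma core_involution_core X : core X -> core (core_involution X).
Proof. by move=> [h1 h2]; split=> //; exact: graded_dual_conj. Qed.

Lemma core_involution_deg lam X : E_core_deg Delta Lg Gam chi D lam X ->
  E_core_deg Delta Lg Gam chi D (- lam) (core_involution X).
Proof. by move=> [h1 h2 h3]; split=> //; [exact: tau_deg | exact: dual_deg_conj]. Qed.

Lemma core_involution_chevalley :
  chevalley_involution core (E_bracket br frm kappa)
    (E_core_deg Delta Lg Gam chi D) (E_core_cartan Delta Lg Gam chi D)
    core_involution.
Proof.
split.
- split.
  + by move=> X /= /core_involution_core.
  + by move=> X Y _ _; apply: (can_inj core_involutionK).
  + move=> X hX; exists (core_involution X); last exact: core_involutionK.
    exact: core_involution_core.
- move=> a [[x1 c1] d1] [[x2 c2] d2] _ _.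
  by rewrite /core_involution /= linear_tau.
- move=> [[x1 c1] d1] [[x2 c2] d2] [h1 d10] [h2 d20].
  rewrite /= in h1 d10 h2 d20; rewrite {}d10 {}d20.
  rewrite E_bracket_core // [RHS]E_bracket_core; try exact: graded_dual_conj.
  rewrite /core_involution /= tau_bracket.
  congr (_, _, _); apply: funext => d; rewrite /sigma_D /=.
  (* Invariance is applied to [tau (d (tau x1))] and [x2]. *)
  by rewrite -[RHS]form_tau tauK.
- by move=> X _; apply: core_involutionK.
- have [x _ hx] := chev_nontrivial htau.
  exists (x, 0, 0); last by case.
  by split=> //; exact: (is_subspace_lspan _).1.
- move=> lam; apply/seteqP; split=> [_ [X hX <-]|X hX].
    exact: core_involution_deg.
  exists (core_involution X); last exact: core_involutionK.
  by rewrite -[lam]opprK; apply: core_involution_deg.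
- move=> [[x c] d] [/= hx hc ->]; rewrite /core_involution /=.
  rewrite (chev_cartan htau hx) (dual_deg0_conj hc).
  by congr (_, _, _); rewrite oppr0.
Qed.

End Core.
End Torus.

Theorem corollary3p3p3 (R : realType)
    (Lam : zmodType) (hLam : free_abelian_of_finite_rank Lam)
    (V : vectType R[i]) (Delta : set V) (coroot : V -> {linear V -> R[i]^o})
    (hDelta : irreducible_root_system Delta coroot)
    (L : lmodType R[i]) (br : L -> L -> L) (Lg : V -> Lam -> set L)
    (hL : lie_torus Delta coroot br Lg) (hcenter : centerless br)
    (Gam : set Lam) (chi : Lam -> L -> L)
    (hchi : centroid_basis Delta br Lg Gam chi)
    (frm : L -> L -> R[i]^o) (hfrm : graded_invariant_form Delta br Lg frm)
    (D : lieSubalg L) (hD : permissible Delta Lg Gam chi D)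
    (hD0 : [set: D] = subalg_deg Delta Lg chi D 0
           \/ [set` subalg_pred D] = SCDer Delta Lg Gam chi)
    (kappa : D -> D -> D -> R[i]^o)
    (hkappa : affine_cocycle Delta Lg Gam chi kappa)
    (tau : L -> L)
    (htau : chevalley_involution [set: L] br (torus_deg Delta Lg) (Lg 0 0) tau) :
  exists tau' : E_ambient D -> E_ambient D,
    chevalley_involution (E_core Delta Lg Gam chi D) (E_bracket br frm kappa)
      (E_core_deg Delta Lg Gam chi D) (E_core_cartan Delta Lg Gam chi D) tau'
    /\ forall x : L, tau' (x, 0, 0) = (tau x, 0, 0).
Proof.
have D_conj d : d \in subalg_pred D -> tau \o d \o tau \in subalg_pred D.
  move=> dD; case: hD0 => hD0'.
    have d0 : subalg_deg Delta Lg chi D 0 (SubalgElt dD) by rewrite -hD0'.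
    suff -> : tau \o d \o tau = - d by rewrite rpredN.
    apply: funext => x.
    exact: (conj_SCDer_deg0 hL hchi htau).
  have sc : [set` subalg_pred D] (tau \o d \o tau).
    by rewrite hD0'; apply: (conj_SCDer hL hfrm hchi htau); rewrite -hD0'.
  exact: sc.
exists (core_involution D_conj); split.
  exact: (core_involution_chevalley hDelta hL hfrm hchi htau hD).
by move=> x.
Qed.
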